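(* There exist constants $c,C>0$ such that for every even $n\ge2$ there is a partial Boolean function $f:S\to\{0,1\}$ with $S\subseteq\{0,1\}^n$ satisfying $\mathrm{CA}_1(f),\mathrm{CA}(f),\mathrm{WA}(f)\le C$ and $\mathrm{KA}(f),\mathrm{MM}(f)\ge c\log n$ (that is, the first three are $O(1)$ and the last two are $\Omega(\log n)$).
   Context: For $x\in S$, $x_i$ is its $i$-th bit. $\mathrm{CA}(f)$: for symmetric $R:S\times S\to\mathbb{R}_{\ge0}$, not identically zero, with $R(x,y)=0$ when $f(x)=f(y)$, let $\theta(x,i)=\sum_yR(x,y)/\sum_{y:x_i\ne y_i}R(x,y)$; $\mathrm{CA}(f)=\max_R\min_{R(x,y)>0,x_i\ne y_i}\max\{\theta(x,i),\theta(y,i)\}$. $\mathrm{CA}_1(f)$ is the same maximum restricted to $R(x,y)=\max\{u(x)v(y),u(y)v(x)\}$ with $u,v:S\to\mathbb{R}_{\ge0}$, $u(x)v(y)=0$ whenever $f(x)=f(y)$. $\mathrm{WA}(f)$: weights $w(x,y)=w(y,x)\ge0$, zero when $f(x)=f(y)$; $w'(x,y,i)\ge0$, zero when $x_i=y_i$ or $f(x)=f(y)$, with $w'(x,y,i),w'(y,x,i)\ge w(x,y)$ when $x_i\ne y_i$; $wt(x)=\sum_yw(x,y)$, $v(x,i)=\sum_yw'(x,y,i)$; $\mathrm{WA}(f)=\max_{w,w'}\min_{w(x,y)\ne0,x_i\ne y_i}\max\{wt(x)/v(x,i),wt(y)/v(y,i)\}$. $\mathrm{KA}(f)=\min_{\sigma\in\{0,1\}^*}\max_{f(x)\ne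 f(y)}\big(\sum_{i:x_i\ne y_i}\min\{2^{-K(i|x,\sigma)},2^{-K(i|y,\sigma)}\}\big)^{-1}$, where $K(i\mid x,\sigma)$ is prefix-free Kolmogorov complexity with respect to a fixed universal Turing machine and prefix-free program set. $\mathrm{MM}(f)=\min_{\{p_x\}}\max_{f(x)\ne f(y)}\big(\sum_{i:x_i\ne y_i}\min\{p_x(i),p_y(i)\}\big)^{-1}$ over families of probability distributions $p_x$ on $[n]$. *)

(* Defs.v *)
From Stdlib Require Import PArith.
From mathcomp Require Import all_boot all_order all_algebra.
From mathcomp Require Import all_classical all_reals all_analysis.

Set Implicit Arguments.
Unset Strict Implicit.
Unset Printing Implicit Defensive.

Import Order.TTheory GRing.Theory Num.Theory.
Import numFieldNormedType.Exports.

Local Open Scope classical_set_scope.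
Local Open Scope ring_scope.

(* Single-tape Turing machines over the tape alphabet {0, 1, blank}, encoded  *)
(* as [option bool] with [None] the blank.  [tm_delta] returns [None] to halt;*)
(* otherwise it gives the new state, the symbol to write and the head move.   *)
Inductive move := MoveL | Stay | MoveR.

Record tm := TM {
  tm_state : finType;
  tm_start : tm_state;
  tm_delta : tm_state -> option bool ->
             option (tm_state * option bool * move) }.

(* State, cells to the left of the head (nearest first), and cells from the   *)
(* head rightwards; all cells not listed are blank.                           *)
Definition config (M : tm) : Type :=
  tm_state M * seq (option bool) * seq (option bool).

Definition tm_init (M : tm) (w : seq bool) : config M :=
  (tm_start M, [::], map Some w).

Definition tm_step (M : tm) (c : config M) : option (config M) :=
  let: (q, l, r) := c in
  if tm_delta q (head None r) is Some (q', a, m) then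
    Some (match m with
          | MoveL => (q', behead l, head None l :: a :: behead r)
          | Stay => (q', l, a :: behead r)
          | MoveR => (q', a :: l, behead r)
          end)
  else None.

(* The output is the block of bits from the head up to the first blank. *)
Fixpoint leading_bits (r : seq (option bool)) : seq bool :=
  if r is Some b :: r' then b :: leading_bits r' else [::].

Fixpoint tm_run (M : tm) (k : nat) (c : config M) : option (seq bool) :=
  match tm_step c with
  | None => Some (leading_bits c.2)
  | Some c' => if k is k'.+1 then tm_run k' c' else None
  end.

Definition tm_eval (M : tm) (w v : seq bool) : Prop :=
  exists k, tm_run k (tm_init M w) = Some v.

(* Self-delimiting pairing: the bits of [u] doubled, the marker 01, then [v]. *)
Definition str_pair (u v : seq bool) : seq bool :=
  flatten [seq [:: b; b] | b <- u] ++ [:: false; true] ++ v.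

Definition universal_tm (U : tm) : Prop :=
  forall M : tm, exists e : seq bool,
    forall w v : seq bool, tm_eval U (str_pair e w) v <-> tm_eval M w v.

Definition prefix_free (P : set (seq bool)) : Prop :=
  forall p q : seq bool, P p -> P q -> prefix p q -> p = q.

(* Binary expansion, least significant bit first. *)
Fixpoint pos_bits (k : positive) : seq bool :=
  match k with
  | xH => [:: true]
  | xO k' => false :: pos_bits k'
  | xI k' => true :: pos_bits k'
  end.

(* An index i : 'I_n stands for the position i + 1 in {1, ..., n}. *)
Definition index_str (n : nat) (i : 'I_n) : seq bool :=
  pos_bits (Pos.of_succ_nat i).

(* K(a | b); equal to +oo when no program of P outputs a on input b. *)
Definition kolmogorov (R : realType) (U : tm) (P : set (seq bool))
    (a b : seq bool) : \bar R :=
  ereal_inf [set (size p)%:R%:E |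
              p in [set p | P p /\ tm_eval U (str_pair p b) a]].

(* 2^-k, with 2^-oo = 0; the argument is never -oo. *)
Definition pow2N (R : realType) (k : \bar R) : R :=
  if k is r%:E then 2 `^ (- r) else 0.

Section Bounds.
Variables (R : realType) (n : nat) (S : {set n.-tuple bool}).
Local Notation D := {x : n.-tuple bool | x \in S}.
Variable f : D -> bool.

Definition bit (x : D) (i : 'I_n) : bool := tnth (val x) i.

Definition CA_scheme (r : D -> D -> R) : Prop :=
  [/\ forall x y, 0 <= r x y,
      forall x y, r x y = r y x,
      exists x y, r x y != 0
    & forall x y, f x = f y -> r x y = 0].

Definition theta (r : D -> D -> R) (x : D) (i : 'I_n) : R :=
  (\sum_y r x y) / (\sum_(y | bit x i != bit y i) r x y).

Definition CA_value (r : D -> D -> R) : \bar R :=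
  ereal_inf [set z | exists x y i, [/\ 0 < r x y, bit x i != bit y i
    & z = (Num.max (theta r x i) (theta r y i))%:E]].

Definition CA : \bar R := ereal_sup [set CA_value r | r in CA_scheme].

Definition rank_one (r : D -> D -> R) : Prop :=
  exists u v : D -> R,
    [/\ forall x, 0 <= u x,
        forall x, 0 <= v x,
        forall x y, f x = f y -> u x * v y = 0
      & forall x y, r x y = Num.max (u x * v y) (u y * v x)].

Definition CA1 : \bar R :=
  ereal_sup [set CA_value r | r in CA_scheme `&` rank_one].

(* The weights w are required not to vanish identically: otherwise the        *)
(* minimum defining the value of the scheme ranges over the empty set.        *)
Definition WA_scheme (w : D -> D -> R) (w' : D -> D -> 'I_n -> R) : Prop :=
  [/\ [/\ forall x y, 0 <= w x y,
          forall x y, w x y = w y x,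
          exists x y, w x y != 0
        & forall x y, f x = f y -> w x y = 0],
      forall x y i, 0 <= w' x y i,
      forall x y i, bit x i = bit y i \/ f x = f y -> w' x y i = 0
    & forall x y i, bit x i != bit y i ->
        w x y <= w' x y i /\ w x y <= w' y x i].

Definition WA_value (w : D -> D -> R) (w' : D -> D -> 'I_n -> R) : \bar R :=
  let wt x := \sum_y w x y in
  let v x i := \sum_y w' x y i in
  ereal_inf [set z | exists x y i, [/\ w x y != 0, bit x i != bit y i
    & z = (Num.max (wt x / v x i) (wt y / v y i))%:E]].

Definition WA : \bar R :=
  ereal_sup [set z | exists w w', WA_scheme w w' /\ z = WA_value w w'].

(* Common shape of the last two bounds; the inverse of 0 is +oo. *)
Definition minimax_value (p : D -> 'I_n -> R) : \bar R :=
  ereal_sup [set z | exists x y, f x <> f y /\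
    z = ((\sum_(i < n | bit x i != bit y i) Num.min (p x i) (p y i))%:E^-1)%E].

Definition KA (U : tm) (P : set (seq bool)) : \bar R :=
  ereal_inf (range (fun sigma : seq bool =>
    minimax_value (fun x i =>
      pow2N (kolmogorov R U P (index_str i) (str_pair (val x) sigma))))).

Definition distribution_family (p : D -> 'I_n -> R) : Prop :=
  (forall x i, 0 <= p x i) /\ (forall x, \sum_i p x i = 1).

Definition MM : \bar R :=
  ereal_inf [set minimax_value p | p in distribution_family].

End Bounds.

Arguments CA R {n S} f.
Arguments CA1 R {n S} f.
Arguments WA R {n S} f.
Arguments KA R {n S} f U P.
Arguments MM R {n S} f.

(* Main.v *)
Require Import Defs.
From Stdlib Require Import PArith.
From mathcomp Require Import all_boot all_order all_algebra.
From mathcomp Require Import all_classical all_reals all_analysis.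
From mathcomp Require Import zify ring lra.
Import Order.TTheory GRing.Theory Num.Theory.
Local Open Scope classical_set_scope.
Local Open Scope ring_scope.

(* The function is ordered search: the inputs are the strings 1^i 0^(n-i) and
   the value is the parity of i.  For MM and KA, weigh the pair i < j with odd
   j - i by 1/(j - i).  The total weight is of order n log n, whereas charging
   min(p_i(k), p_j(k)) to whichever of i and j is farther from k puts weight
   at most 1 on each p_i(k).  Kraft's inequality makes 2^-K(k|x) a
   subdistribution, so the same bound covers KA. *)

(** * Determinism of Turing machines and injectivity of the index code *)

Lemma tm_run_extend (M : tm) k k' (c : config M) v :
  (k <= k')%N -> tm_run k c = Some v -> tm_run k' c = Some v.
Proof.
elim: k k' c => [|k IHk] [|k'] c //= lekk'; case: (tm_step c) => // c' Hc'.
exact: IHk.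
Qed.

Lemma tm_eval_functional {M : tm} {w v v'} :
  tm_eval M w v -> tm_eval M w v' -> v = v'.
Proof.
move=> [k Hk] [k' Hk'].
have := tm_run_extend _ _ (maxn k k') _ _ (leq_maxl _ _) Hk.
by rewrite (tm_run_extend _ _ _ _ _ (leq_maxr k k') Hk') => -[].
Qed.

Lemma pos_bits_inj : injective pos_bits.
Proof.
have ne p : pos_bits p <> [::] by case: p.
elim=> [p IHp|p IHp|] [q|q|] //= [].
- by move=> /IHp->.
- by move=> /ne.
- by move=> /IHp->.
- by move=> /esym/ne.
Qed.

Lemma index_str_inj n : injective (@index_str n).
Proof.
by move=> i j /pos_bits_inj /SuccNat2Pos.inj /ord_inj.
Qed.

(** * Kraft's inequality and its use for Kolmogorov complexity *)

(** Induction on a bound for the lengths. An empty string is a prefix of all others, hence the only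
    one; otherwise split by the first bit, whose removal bounds each half by 1/2. *)
Lemma kraft (R : realType) (I : finType) (Q : pred I) (g : I -> seq bool) :
  (forall i j, Q i -> Q j -> prefix (g i) (g j) -> i = j) ->
  \sum_(i | Q i) (2^-1 : R) ^+ size (g i) <= 1.
Proof.
have [N] : exists N, forall i, (size (g i) <= N)%N.
  by exists (\max_i size (g i))%N => i; exact: leq_bigmax.
elim: N Q g => [|N IHN] Q g gN gP.
  have Q1 i j : Q i -> Q j -> i = j.
    move=> Qi Qj; apply: gP => //.
    by have := gN i; rewrite leqn0 size_eq0 => /eqP ->; rewrite prefix0s.
  case: (pickP Q) => [i Qi|Q0]; last by rewrite big_pred0.
  rewrite (bigD1 i) //= big_pred0 ?addr0; last first.
    by move=> j; apply/negbTE/negP => /andP[/Q1 /(_ Qi) -> /eqP].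
  by rewrite exprn_ile1 ?invr_ge0 ?invf_le1// ?ler1n.
case: (pickP [pred i | Q i & g i == [::]]) => [i /andP[Qi /eqP gi]|gne].
  rewrite (bigD1 i) //= big_pred0 ?addr0 ?gi//.
  move=> j; apply/negbTE/negP => /andP[Qj /eqP ji].
  by apply: ji; apply/esym/gP; rewrite // gi prefix0s.
have half b : \sum_(i | Q i && (head false (g i) == b))
    (2^-1 : R) ^+ size (g i) <= 2^-1.
  rewrite (eq_bigr (fun i => 2^-1 * 2^-1 ^+ size (behead (g i)))); last first.
    move=> i /andP[Qi _]; have gi0 := gne i; rewrite /= Qi /= in gi0.
    move: gi0; case: (g i) => [|a s] gi0; last by rewrite exprS.
    by rewrite eqxx in gi0.
  rewrite -mulr_sumr ler_piMr ?invr_ge0//; apply: IHN.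
    by move=> i; rewrite size_behead; have := gN i; case: (size _).
  move=> i j /andP[Qi /eqP bi] /andP[Qj /eqP bj] pij; apply: gP => //.
  move: (gne i) (gne j) bi bj pij; rewrite /= Qi Qj /=.
  by case: (g i) (g j) => [|a s] [|a' s'] //= _ _ -> ->; rewrite eqxx.
rewrite (bigID (fun i => head false (g i) == true)) /=.
apply: (@le_trans _ _ (2^-1 + 2^-1)); last by lra.
rewrite lerD ?half//; apply: le_trans (half false).
by rewrite le_eqVlt; apply/orP; left; apply/eqP/eq_bigl => i; case: (head _ _).
Qed.

(* Programs printing distinct outputs are distinct, so Kraft's inequality
   applies to the shortest ones. *)
Lemma sum_pow2N_kolmogorov_le1 (R : realType) (U : tm) (P : set (seq bool))
    (I : finType) (a : I -> seq bool) (b : seq bool) :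
  prefix_free P -> injective a ->
  \sum_i pow2N (kolmogorov R U P (a i) b) <= 1.
Proof.
move=> Pfree a_inj.
pose A i := [set p | P p /\ tm_eval U (str_pair p b) (a i)].
have shortest i : exists p, (A i p /\ pow2N (kolmogorov R U P (a i) b) =
      2^-1 ^+ size p) \/ (A i = set0 /\ p = [::]).
  have [->|] := eqVneq (A i) set0; first by exists [::]; right.
  case/set0P => p0 Ap0.
  have : exists k, `[< exists2 p, A i p & size p = k >].
    by exists (size p0); apply/asboolP; exists p0.
  move=> exk; case: (ex_minnP exk) => _ /asboolP[p Ap <-] pmin.
  exists p; left; split=> //.
  suff -> : kolmogorov R U P (a i) b = (size p)%:R%:E.
    by rewrite /= powRN powR_mulrn// exprVn.
  apply/eqP; rewrite eq_le; apply/andP; split.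
    by apply: ge_ereal_inf; exists (size p)%:R%:E => //; exists p.
  apply: le_ereal_inf_tmp => _ [q Aq <-].
  by rewrite lee_fin ler_nat pmin//; apply/asboolP; exists q.
have [g gP] := choice shortest.
(* Outputs that no program prints have complexity [+oo] and contribute 0. *)
rewrite (bigID (fun i => `[< A i (g i) >])) /=.
rewrite [X in _ + X]big1 ?addr0; last first.
  move=> i /asboolPn nAg; have [[]//|[A0 _]] := gP i.
  by rewrite /kolmogorov -/(A i) A0 image_set0 ereal_inf0.
rewrite (eq_bigr (fun i => 2^-1 ^+ size (g i))); last first.
  move=> i /asboolP Ag; have [[]//|[A0 _]] := gP i.
  by rewrite A0 in Ag.
apply: kraft => i j /asboolP[Pi Ui] /asboolP[Pj Uj] pij; apply: a_inj.
by apply: (tm_eval_functional Ui); rewrite (Pfree _ _ Pi Pj pij).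
Qed.

(** * Harmonic weights on pairs of points *)

Lemma sum_window_le1 (R : realFieldType) N (Q : pred 'I_N) (F : 'I_N -> R) u a :
  (forall j, Q j -> (u <= j < u + a)%N && (F j <= a%:R^-1)) ->
  \sum_(j | Q j) F j <= 1.
Proof.
move=> QF.
case: (posnP a) QF => [->|a_gt0] QF.
  rewrite big_pred0 ?ler01// => j; apply/negbTE/negP => /QF.
  by rewrite addn0; case: ltngtP.
apply: (@le_trans _ _ (\sum_(j | Q j) a%:R^-1)).
  by apply: ler_sum => j /QF /andP[].
rewrite sumr_const -[_ *+ #|_|]mulr_natl ler_pdivrMr ?ltr0n// mul1r ler_nat.
rewrite cardE -(size_map val) -(size_iota u a) uniq_leq_size//.
  by rewrite map_inj_uniq ?enum_uniq//; exact: val_inj.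
move=> _ /mapP[j jQ ->]; move: jQ; rewrite mem_enum => /QF /andP[uj _].
by rewrite mem_iota.
Qed.

(** Passing from 2e+1 to 2e+3 raises the logarithm by ln(1 + 2/(2e+1)) <= 2/(2e+1), twice the new
    term of the sum. *)
Lemma ln_le_sum_odd_inv (R : realType) M :
  ln M.+1%:R <= 2 * \sum_(0 <= d < M | ~~ odd d) (d.+1%:R^-1 : R).
Proof.
pose G M := \sum_(0 <= d < M | ~~ odd d) (d.+1%:R^-1 : R).
have GS k : G k.+1 = G k + (if odd k then 0 else k.+1%:R^-1).
  by rewrite /G big_mkcond big_nat_recr//= -big_mkcond; case: (odd k).
have Geven e : ln (e.*2.+1%:R : R) <= 2 * G e.*2.
  elim: e => [|e IHe]; first by rewrite /G big_geq// ln1 mulr0.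
  rewrite doubleS !GS /= odd_double /= addr0.
  have e0 : 0 < e.*2.+1%:R :> R by rewrite ltr0n.
  have -> : e.*2.+3%:R = e.*2.+1%:R * (1 + 2 / e.*2.+1%:R) :> R.
    by rewrite mulrDr mulr1 mulrCA divff ?gt_eqF// mulr1 -natrD addn2.
  have d0 : 0 < 2 / e.*2.+1%:R :> R by rewrite divr_gt0.
  rewrite lnM ?posrE ?addr_gt0// mulrDr lerD//.
  by apply: le_ln1Dx; apply: lt_trans d0; rewrite ltrN10.
(* For odd [M] the term d = M is absent, so the even case at [M.+1] applies. *)
rewrite -/(G M) -[M]odd_double_half; case: (odd M); rewrite ?add0n ?add1n//.
have := Geven M./2.+1; rewrite doubleS [G _.+2]GS /= odd_double addr0.
apply: le_trans.
by rewrite ler_ln ?posrE ?ltr0n// ler_nat.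
Qed.

Lemma sum_min_inv_dist_le (R : realFieldType) n (q : 'I_n.+1 -> 'I_n -> R) :
  (forall i k, 0 <= q i k) -> (forall i, \sum_k q i k <= 1) ->
  \sum_(i < n.+1) \sum_(j < n.+1 | (i < j)%N) (j - i)%:R^-1 *
    (\sum_(k < n | (i <= k < j)%N) Num.min (q i k) (q j k)) <= n.+1%:R.
Proof.
move=> q_ge0 q_le1.
(* Position [k] lies between the points k and k+1, so its distances to [i] and [j] are taken as
   k+1-i and j-k. When [j] is the closer one, or on a tie, the minimum is charged to [i]. *)
pose close (i j : 'I_n.+1) (k : 'I_n) := (j - k <= k.+1 - i)%N.
pose A (i j : 'I_n.+1) (k : 'I_n) : R :=
  if (i <= k < j)%N && close i j k then (j - i)%:R^-1 else 0.
pose B (i j : 'I_n.+1) (k : 'I_n) : R :=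
  if (i <= k < j)%N && ~~ close i j k then (j - i)%:R^-1 else 0.
have inv_ge0 (i j : nat) : 0 <= (j - i)%:R^-1 :> R by rewrite invr_ge0 ler0n.
apply: (@le_trans _ _ (\sum_i \sum_j \sum_k
  (A i j k * q i k + B i j k * q j k))).
  apply: ler_sum => i _; rewrite big_mkcond; apply: ler_sum => j _.
  have AB0 k : 0 <= A i j k * q i k + B i j k * q j k.
    by rewrite /A /B addr_ge0//; case: ifP => _; rewrite ?mul0r// mulr_ge0.
  case: ifP => [ij|_]; last exact: sumr_ge0.
  rewrite mulr_sumr big_mkcond; apply: ler_sum => k _.
  case: ifP => // ikj; rewrite /A /B ikj; case: (close i j k) => /=.
    by rewrite mul0r addr0 ler_wpM2l// ge_min lexx.
  by rewrite mul0r add0r ler_wpM2l// ge_min lexx orbT.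
(* For fixed [i] and [k], the charged [j] lie in a window of k+1-i points starting at k+1, all at
   distance at least k+1-i from [i]. *)
have loadA i k : \sum_j A i j k <= 1.
  rewrite /A -big_mkcond; apply: (@sum_window_le1 _ _ _ _ k.+1 (k.+1 - i)) => j.
  rewrite /close => /andP[/andP[ik kj] njk]; apply/andP; split; first lia.
  by rewrite lef_pV2 ?posrE ?ltr0n ?ler_nat; lia.
have loadB j k : \sum_i B i j k <= 1.
  rewrite /B -big_mkcond.
  apply: (@sum_window_le1 _ _ _ _ (k.+1 - (j - k)) (j - k)) => i.
  rewrite /close => /andP[/andP[ik kj] njk]; apply/andP; split; first lia.
  by rewrite lef_pV2 ?posrE ?ltr0n ?ler_nat; lia.
(* Whether x <= k decides if [x] can be the left or the right end of a pair separated by [k], so one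
   of the two loads vanishes. *)
have load x k : \sum_j A x j k + \sum_i B i x k <= 1.
  have [xk|kx] := leqP x k.
    rewrite [X in _ + X]big1 ?addr0// => i _.
    by rewrite /B; case: ifP => //; lia.
  rewrite big1 ?add0r// => j _.
  by rewrite /A; case: ifP => //; lia.
have -> : \sum_i \sum_j \sum_k (A i j k * q i k + B i j k * q j k) =
    \sum_x \sum_k (\sum_j A x j k + \sum_i B i x k) * q x k.
  under eq_bigr do under eq_bigr do rewrite big_split.
  under eq_bigr do rewrite big_split.
  rewrite big_split /= [X in _ + X]exchange_big -big_split.
  apply: eq_bigr => x _.
  rewrite /= [X in X + _]exchange_big [X in _ + X]exchange_big -big_split.
  by apply: eq_bigr => k _; rewrite mulrDl !mulr_suml.
rewrite -[n.+1 in leRHS]card_ord -[leRHS]mulr1 mulr_natl -sumr_const.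
apply: ler_sum => x _; apply: le_trans (q_le1 x).
by apply: ler_sum => k _; rewrite ler_piMl.
Qed.

(** The separation hypothesis, summed against the weights, gives W <= L (n+1); this is compared with
    4 W >= (n/2 + 1) ln n. *)
Lemma ln_le_of_separated (R : realType) n (q : 'I_n.+1 -> 'I_n -> R) (L : R) :
  ~~ odd n -> (2 <= n)%N -> 0 <= L ->
  (forall i k, 0 <= q i k) -> (forall i, \sum_k q i k <= 1) ->
  (forall i j : 'I_n.+1, (i < j)%N -> odd (j - i) ->
    1 <= L * \sum_(k < n | (i <= k < j)%N) Num.min (q i k) (q j k)) ->
  ln n%:R <= 8 * L.
Proof.
move=> n_even n_ge2 L_ge0 q_ge0 q_le1 q_sep.
pose m := n./2.
have nE : n = m.*2 by rewrite -[LHS]odd_double_half (negbTE n_even).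
pose W : R := \sum_(i < n.+1) \sum_(j < n.+1 | (i < j)%N && odd (j - i))
  (j - i)%:R^-1.
have W_le : W <= L * n.+1%:R.
  apply: le_trans (ler_wpM2l L_ge0 (sum_min_inv_dist_le _ _ _ q_ge0 q_le1)).
  rewrite mulr_sumr; apply: ler_sum => i _.
  rewrite mulr_sumr big_mkcondr; apply: ler_sum => j ij.
  case: ifP => [oij|_].
    rewrite mulrCA -[leLHS]mulr1 ler_wpM2l ?invr_ge0//; exact: q_sep.
  rewrite mulr_ge0// mulr_ge0 ?invr_ge0//; apply: sumr_ge0 => k _.
  by rewrite le_min !q_ge0.
have W_ge : m.+1%:R * ln n%:R <= 4 * W.
  (* This is n = 2m <= (m+1)^2. *)
  have ln_m : ln n%:R <= 2 * ln (m.+1%:R : R).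
    rewrite mulr_natl -lnXn ?ltr0n// ler_ln ?posrE ?exprn_gt0 ?ltr0n//;
      last by lia.
    by rewrite -natrX ler_nat nE -mul2n; nia.
  have -> : W = \sum_(0 <= i < n.+1)
      \sum_(0 <= j < n.+1 | (i < j)%N && odd (j - i)) (j - i)%:R^-1.
    by rewrite big_mkord; apply: eq_bigr => i _; rewrite big_mkord.
  have sum_ge0 i a b : 0 <=
      \sum_(a <= j < b | (i < j)%N && odd (j - i)) ((j - i)%:R^-1 : R).
    by apply: sumr_ge0 => j _; rewrite invr_ge0.
  (* Keep only i <= m and i < j <= i + m, which stays within n = 2m. With j = i + 1 + d, an odd j -
     i means an even d. *)
  rewrite (@big_cat_nat _ _ _ m.+1)//=; last lia.
  rewrite mulrDr -[leLHS]addr0 lerD//; last by rewrite mulr_ge0// sumr_ge0.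
  rewrite mulr_natl -[m.+1 in leLHS]subn0 -sumr_const_nat mulr_sumr.
  apply: ler_sum_nat => i /= im.
  rewrite (@big_cat_nat _ _ _ i.+1)//=; last lia.
  rewrite (@big_cat_nat _ _ _ (i.+1 + m) i.+1)//=; [|lia|lia].
  apply: (@le_trans _ _ (4 * \sum_(i.+1 <= j < i.+1 + m |
      (i < j)%N && odd (j - i)) ((j - i)%:R^-1 : R))); last first.
    by rewrite ler_pM2l// addrCA lerDl addr_ge0.
  rewrite -{1}[i.+1]add0n big_addn addKn.
  rewrite (eq_big (fun d => ~~ odd d) (fun d => d.+1%:R^-1)).
  - by have := ln_le_sum_odd_inv R m; lra.
  - by move=> d; rewrite addnS subSn ?leq_addl// addnK ltnS leq_addl.
  - by move=> d _; rewrite addnS subSn ?leq_addl// addnK.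
suff : m.+1%:R * ln n%:R <= m.+1%:R * (8 * L) by rewrite ler_pM2l ?ltr0n.
apply: le_trans W_ge _.
apply: le_trans (ler_wpM2l _ W_le) _ => //.
(* This factor 2 turns the 4 of [W_ge] into the final 8. *)
have : (n.+1%:R : R) <= 2 * m.+1%:R by rewrite -natrM ler_nat; lia.
nra.
Qed.

(** * Adversary bounds and threshold inputs *)

(** The lowest of the light elements has all of them in its tail, and that tail weighs at most
    [B]. *)
Lemma sum_light_tail_le (R : numDomainType) (T : finType) (Q : pred T)
    (h : T -> nat) (g : T -> R) (B : R) : 0 <= B ->
  (forall y, 0 <= g y) ->
  \sum_(y | Q y && (\sum_(z | Q z && (h y <= h z)%N) g z <= B)) g y <= B.
Proof.
move=> B_ge0 g_ge0.
pose E y := Q y && (\sum_(z | Q z && (h y <= h z)%N) g z <= B).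
case: (pickP E) => [y0 Ey0|E0]; last by rewrite (eq_bigl _ _ E0) big_pred0.
case: (arg_minnP h Ey0) => y /andP[Qy yB] ymin.
apply: le_trans yB; rewrite [leLHS]big_mkcond [leRHS]big_mkcond.
apply: ler_sum => z _; case: ifP => [Ez|_]; last by case: ifP.
by rewrite (ymin z Ez)//; case/andP: Ez => ->.
Qed.

Section Adversary.
Context {R : realType} {n : nat} {S : {set n.-tuple bool}}.
Local Notation D := {x : n.-tuple bool | x \in S}.
Variable f : D -> bool.

Lemma CA1_le_CA : (CA1 R f <= CA R f)%E.
Proof. by apply: ereal_sup_le => _ [r [rf _] <-]; exists r. Qed.

Lemma CA_le_WA : (CA R f <= WA R f)%E.
Proof.
apply: ge_ereal_sup => _ [r [r_ge0 rC r_neq0 rf] <-].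
(* Copying [r] onto the separating positions makes the sum of [w'] the denominator of [theta]. *)
pose w' x y i := if bit x i != bit y i then r x y else 0.
apply: ereal_sup_ubound; exists r, w'; split.
  split=> //.
  - by move=> x y i; rewrite /w'; case: ifP.
  - by move=> x y i [xy|/rf xy]; rewrite /w' ?xy ?eqxx//; case: ifP.
  - by move=> x y i xy; rewrite /w' xy eq_sym xy rC.
rewrite /CA_value /WA_value; congr ereal_inf; apply/seteqP.
have thetaE x i : theta r x i = (\sum_y r x y) / (\sum_y w' x y i).
  by rewrite /theta -big_mkcond.
split=> _ [x [y [i [rxy xyi ->]]]]; exists x, y, i; split; rewrite ?thetaE//.
  by rewrite gt_eqF.
by rewrite lt_def rxy r_ge0.
Qed.

(* Call y' beyond y as seen from x if y' lies on the same side of x as y, at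
   least as far away.  The edges xy such that at most a fifth of the weight at
   x lies beyond y carry at most two fifths of the weight at x.  So some edge
   xy has more than a fifth of the weight of each end beyond the other end;
   these weights all contribute to any position separating x from y. *)
Lemma WA_threshold_le5 (pos : D -> nat) :
  (forall x, (pos x <= n)%N) ->
  (forall x i, bit x i = (i < pos x)%N) ->
  (forall x y, pos x = pos y -> f x = f y) ->
  (WA R f <= 5%:E)%E.
Proof.
move=> pos_le bitE pos_f.
apply: ge_ereal_sup => _ [w [w' [wP ->]]].
have [[w_ge0 wC [x0 [y0 w0]] wf] w'_ge0 w'_eq0 w'_w] := wP.
pose wt x := \sum_y w x y.
pose beyond x y z :=
  if (pos x < pos y)%N then (pos y <= pos z)%N else (pos z <= pos y)%N.
pose tail x y := \sum_(z | beyond x y z) w x z.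
have wt_ge0 x : 0 <= wt x by exact: sumr_ge0.
have neq x y : w x y != 0 -> pos x <> pos y.
  by move=> wxy /pos_f/wf; apply/eqP.
pose l x := \sum_(y | (pos x != pos y) && (tail x y <= wt x / 5)) w x y.
have light x : l x <= 2 * (wt x / 5).
  have wt5 : 0 <= wt x / 5 by rewrite divr_ge0.
  rewrite mulr_natl mulr2n /l (bigID (fun y => (pos x < pos y)%N)) /=.
  apply: lerD.
    apply: le_trans (@sum_light_tail_le _ _ (fun y => (pos x < pos y)%N) pos
      (w x) _ wt5 (w_ge0 x)).
    rewrite [leLHS]big_mkcond [leRHS]big_mkcond; apply: ler_sum => y _.
    case: ifP => [/andP[/andP[_ ty] xy]|_]; last by case: ifP.
    case: ifP => //; rewrite xy /= => /negP[].
    apply: le_trans ty.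
    rewrite /tail /beyond xy [leLHS]big_mkcond [leRHS]big_mkcond.
    by apply: ler_sum => z _; case: ifP => [/andP[_ ->]|]//; case: ifP.
  (* To the left of [x] the order is reversed, hence the height n - pos y. *)
  apply: le_trans (@sum_light_tail_le _ _ (fun y => (pos y < pos x)%N)
    (fun y => n - pos y)%N (w x) _ wt5 (w_ge0 x)).
  rewrite [leLHS]big_mkcond [leRHS]big_mkcond; apply: ler_sum => y _.
  case: ifP => [/andP[/andP[nxy ty] xy]|_]; last by case: ifP.
  have yx : (pos y < pos x)%N by lia.
  case: ifP => //; rewrite yx /= => /negP[].
  apply: le_trans ty.
  rewrite /tail /beyond (negbTE xy) [leLHS]big_mkcond [leRHS]big_mkcond.
  apply: ler_sum => z _; case: ifP => [/andP[zx zy]|_]; last by case: ifP.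
  by have := pos_le z; have := pos_le y; case: ifP => //; lia.
have [x [y [wxy tx ty]]] : exists x y, [/\ w x y != 0,
    wt x / 5 < tail x y & wt y / 5 < tail y x].
  (* Otherwise every edge is light at one of its ends, and the positive total weight is at most 2 *
     2/5 of itself. Any constant above 4 in place of 5 gives this contradiction. *)
  apply: contrapT => none.
  have total_gt0 : 0 < \sum_x wt x.
    rewrite (bigD1 x0)//= ltr_pwDl//; last exact: sumr_ge0.
    rewrite /wt (bigD1 y0)//= ltr_pwDl//; last exact: sumr_ge0.
    by rewrite lt_def w0 w_ge0.
  have : \sum_x wt x <= \sum_x l x + \sum_x l x.
    have -> : \sum_x l x + \sum_x l x = \sum_x \sum_y
        ((if (pos x != pos y) && (tail x y <= wt x / 5) then w x y else 0) +
         (if (pos y != pos x) && (tail y x <= wt y / 5) then w y x else 0)).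
      under [RHS]eq_bigr do rewrite big_split.
      rewrite big_split /= [X in _ = _ + X]exchange_big.
      by congr (_ + _); apply: eq_bigr => x _; rewrite /l big_mkcond.
    apply: ler_sum => x _; apply: ler_sum => y _.
    have [->|wxy] := eqVneq (w x y) 0.
      by rewrite addr_ge0//; case: ifP.
    have /eqP nxy := neq _ _ wxy; rewrite (eq_sym (pos y)) nxy /= (wC y x).
    have [tx|tx] := leP (tail x y); first by rewrite lerDl; case: ifP.
    have [ty|ty] := leP (tail y x); first by rewrite lerDr.
    by case: none; exists x, y.
  have : \sum_x l x <= \sum_x 2 * (wt x / 5).
    by apply: ler_sum => x _; exact: light.
  rewrite -mulr_sumr -mulr_suml; lra.
wlog xy : x y wxy tx ty / (pos x < pos y)%N.
  move=> H; case: (ltngtP (pos x) (pos y)) => [| |/(neq _ _ wxy)//].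
    exact: H.
  by apply: H; rewrite // wC.
(* The first position where [x] and [y] differ: inputs at or below [pos x] have 0 there, inputs at
   or above [pos y] have 1. As the value is an infimum, one position suffices. *)
have xn : (pos x < n)%N by have := pos_le y; lia.
pose k := Ordinal xn.
have heavy u u' : bit u k != bit u' k ->
   (forall z, beyond u u' z -> bit u k != bit z k) ->
   wt u / 5 < tail u u' -> wt u / (\sum_z w' u z k) <= 5.
  move=> uu' beyond_diff tu.
  have tw : tail u u' <= \sum_z w' u z k.
    rewrite /tail big_mkcond; apply: ler_sum => z _.
    case: ifP => // /beyond_diff.
    by move=> /w'_w[].
  have w'_gt0 : 0 < \sum_z w' u z k.
    by apply: lt_le_trans tw; apply: le_lt_trans tu; rewrite divr_ge0.
  rewrite ler_pdivrMr// mulrC -ler_pdivrMr//.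
  by apply: le_trans tw; exact: ltW.
have xyk : bit x k != bit y k by rewrite !bitE /= ltnn xy.
apply: ge_ereal_inf.
exists (Num.max (wt x / \sum_z w' x z k) (wt y / \sum_z w' y z k))%:E.
  by exists x, y, k; split.
rewrite lee_fin ge_max (heavy x y)//=.
  rewrite (heavy y x)// 1?eq_sym// => z; rewrite /beyond !bitE /=.
  by rewrite ltnNge (ltnW xy) /= => ?; lia.
by move=> z; rewrite /beyond xy !bitE /=; lia.
Qed.

End Adversary.

(** * Ordered search on thermometer strings *)

Section Thermometer.
Variable n : nat.

Definition thermometer (i : nat) : n.-tuple bool := [tuple (k < i)%N | k < n].

Definition thermometers : {set n.-tuple bool} :=
  [set thermometer (nat_of_ord i) | i : 'I_n.+1].

Definition ones (x : {x : n.-tuple bool | x \in thermometers}) : nat :=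
  count id (val x).

Definition ones_parity x := odd (ones x).

Lemma thermometerP (i : 'I_n.+1) : thermometer i \in thermometers.
Proof. exact: imset_f. Qed.

Definition point (i : 'I_n.+1) : {x : n.-tuple bool | x \in thermometers} :=
  exist _ (thermometer i) (thermometerP i).

Lemma count_thermometer i : (i <= n)%N -> count id (thermometer i) = i.
Proof.
move=> le_in; rewrite /= count_map -sum1_count.
rewrite big_mkcond big_enum -big_mkcond /=.
by rewrite -(big_ord_widen _ (fun=> 1%N) le_in) sum_nat_const card_ord muln1.
Qed.

Lemma ones_point i : ones (point i) = i.
Proof. by rewrite /ones count_thermometer// -ltnS. Qed.

Lemma ones_le x : (ones x <= n)%N.
Proof. by rewrite -(size_tuple (val x)) count_size. Qed.

Lemma bit_thermometers x i : bit x i = (i < ones x)%N.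
Proof.
have /imsetP[j _ xj] := valP x.
have jn : (j <= n)%N by rewrite -ltnS.
by rewrite /bit /ones xj (count_thermometer _ jn) tnth_mktuple.
Qed.

End Thermometer.

(** Row sums are only bounded by 1, so that the weights 2^-K are covered along with
    distributions. *)
Lemma minimax_value_thermometers_ge (R : realType) n
    (p : {x : n.-tuple bool | x \in thermometers n} -> 'I_n -> R) :
  ~~ odd n -> (2 <= n)%N ->
  (forall x i, 0 <= p x i) -> (forall x, \sum_i p x i <= 1) ->
  ((8^-1 * ln n%:R)%:E <= minimax_value (@ones_parity n) p)%E.
Proof.
move=> n_even n_ge2 p_ge0 p_le1.
rewrite leNgt; apply/negP => small.
have ln_gt0 : 0 < ln (n%:R : R) by rewrite ln_gt0// ltr1n.
(* Truncation at 0 turns a negative value or [-oo] into a nonnegative real bound, still below the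
   target since ln n > 0. *)
have [l [l_ge0 lL lp]] : exists l : R, [/\ 0 <= l, l < 8^-1 * ln n%:R &
    (minimax_value (@ones_parity n) p <= l%:E)%E].
  move: small; case: (minimax_value _ _) => [r| |] //.
    rewrite lte_fin => rln; exists (Num.max 0 r).
    by rewrite le_max lexx gt_max rln lee_fin le_max lexx orbT mulr_gt0.
  by move=> _; exists 0; rewrite lexx mulr_gt0// leNye.
have : ln n%:R <= 8 * l; last by lra.
apply: (@ln_le_of_separated _ _ (fun i k => p (point n i) k)) => //.
move=> i j ij odd_ij.
set s := \sum_(k < n | _) _.
have s_ge0 : 0 <= s by apply: sumr_ge0 => k _; rewrite le_min !p_ge0.
have : ((s%:E)^-1 <= l%:E)%E.
  apply: le_trans lp; apply: ereal_sup_ubound.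
  exists (point n i), (point n j); split.
    by rewrite /ones_parity !ones_point; lia.
  congr (_%:E^-1)%E; apply: eq_bigl => k; rewrite !bit_thermometers !ones_point.
  by lia.
(* The inverse of 0 is [+oo], which the finite bound [l] excludes; so s > 0 and 1 <= l s. *)
rewrite inver; case: eqP => // /eqP s0; rewrite lee_fin => sl.
have s_gt0 : 0 < s by rewrite lt_def s0.
by rewrite -ler_pdivrMr// div1r.
Qed.

Theorem theorem3 (R : realType) (U : tm) (P : set (seq bool))
    (hU : universal_tm U) (hP : prefix_free P) :
  exists c C : R, [/\ 0 < c, 0 < C &
    forall n : nat, ~~ odd n -> (2 <= n)%N ->
    exists (S : {set n.-tuple bool}) (f : {x : n.-tuple bool | x \in S} -> bool),
      [/\ (CA1 R f <= C%:E)%E,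
          (CA R f <= C%:E)%E,
          (WA R f <= C%:E)%E,
          ((c * ln n%:R)%:E <= KA R f U P)%E
        & ((c * ln n%:R)%:E <= MM R f)%E]].
Proof.
(* The 8 comes from [ln_le_of_separated], the 5 from [WA_threshold_le5]; as CA1 <= CA <= WA, the
   bound on WA serves all three. *)
exists 8^-1, 5; split; rewrite ?invr_gt0// => n n_even n_ge2.
exists (thermometers n), (@ones_parity n).
have WA_le : (WA R (@ones_parity n) <= 5%:E)%E.
  apply: (@WA_threshold_le5 _ _ _ _ (@ones n)) => [x|x i|x y xy].
  - exact: ones_le.
  - exact: bit_thermometers.
  - by rewrite /ones_parity xy.
have CA_le := le_trans (CA_le_WA _) WA_le.
split=> //.
- exact: le_trans (CA1_le_CA _) CA_le.
- apply: le_ereal_inf_tmp => _ [sigma _ <-].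
  apply: minimax_value_thermometers_ge => // [x i|x].
    by rewrite /pow2N; case: (kolmogorov _ _ _ _ _) => // r; exact: powR_ge0.
  exact: sum_pow2N_kolmogorov_le1 (@index_str_inj n).
- apply: le_ereal_inf_tmp => _ [p [p_ge0 p_sum1] <-].
  by apply: minimax_value_thermometers_ge => // x; rewrite p_sum1.
Qed.
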